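(* Let $N\in\mathbb{N}_+$ and let $(x_1,y_1),\dots,(x_N,y_N)\in\mathbb{R}\times\mathbb{R}$ with $x_k<x_{k+1}$ for $k=1,\dots,N-1$. There exists a ReLU MLP $\Phi:\mathbb{R}\to\mathbb{R}$ of width at most $2\lceil\sqrt N\rceil$, depth $2$, and with at most $2N+8\lceil\sqrt N\rceil$ nonzero parameters such that $$\Phi(x_k)=y_k\qquad\text{for }k=1,\dots,N.$$ Furthermore, $\Phi$ is linear (affine) on each interval $[x_k,x_{k+1}]$, $k=1,\dots,N-1$, and constant on each of $(-\infty,x_1]$ and $[x_N,\infty)$.
   Context: ReLU MLP: a function $\Phi:\mathbb{R}^{d_1}\to\mathbb{R}^{d_{\Delta+1}}$ with a representation $\mathbf{x}^{(1)}=\mathbf{x}$, $\mathbf{x}^{(l+1)}=\operatorname{ReLU}(\mathbf{W}^{(l)}\mathbf{x}^{(l)}+\mathbf{b}^{(l)})$ for $l=1,\dots,\Delta-1$ (ReLU$(t)=\max\{0,t\}$ applied componentwise), $\Phi(\mathbf{x})=\mathbf{W}^{(\Delta)}\mathbf{x}^{(\Delta)}+\mathbf{b}^{(\Delta)}$, where $\mathbf{W}^{(l)}\in\mathbb{R}^{d_{l+1}\times d_l}$ and $\mathbf{b}^{(l)}\in\mathbb{R}^{d_{l+1}}$. Its depth is $\Delta-1$ (number of hidden layers), its width is $\max_{2\le l\le\Delta}d_l$, and the number of nonzero parameters is the total number of nonzero entries of all $\mathbf{W}^{(l)},\mathbf{b}^{(l)}$. *)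

(* Defs.v *)
From HB Require Import structures.
From mathcomp Require Import all_boot all_order all_algebra.
From mathcomp Require Import reals.

Set Implicit Arguments.
Unset Strict Implicit.
Unset Printing Implicit Defensive.

Import Order.TTheory GRing.Theory Num.Theory.

Local Open Scope ring_scope.

(* A network is a chain of hidden layers closed by one affine output layer.
   Vectors are columns, so a layer from R^m to R^n is a pair (W, b) with
   W : 'M_(n, m) and b : 'cV_n. *)
Inductive relu_mlp (R : realType) : nat -> nat -> Type :=
| MlpOutput m n (W : 'M[R]_(n, m)) (b : 'cV[R]_n) : relu_mlp R m n
| MlpHidden m k n (W : 'M[R]_(k, m)) (b : 'cV[R]_k)
    (net : relu_mlp R k n) : relu_mlp R m n.

Definition relu (R : realType) (t : R) : R := Num.max 0 t.

Fixpoint mlp_eval (R : realType) m n (net : relu_mlp R m n) :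
    'cV[R]_m -> 'cV[R]_n :=
  match net in relu_mlp _ m n return 'cV[R]_m -> 'cV[R]_n with
  | MlpOutput _ _ W b => fun x => W *m x + b
  | MlpHidden _ _ _ W b net' =>
      fun x => mlp_eval net' (map_mx (@relu R) (W *m x + b))
  end.

Definition mlp_fun (R : realType) (net : relu_mlp R 1 1) (t : R) : R :=
  mlp_eval net (const_mx t) 0 0.

Fixpoint mlp_depth (R : realType) m n (net : relu_mlp R m n) : nat :=
  match net with
  | MlpOutput _ _ _ _ => 0
  | MlpHidden _ _ _ _ _ net' => (mlp_depth net').+1
  end.

(* Only hidden layers count; the input and output dimensions do not. *)
Fixpoint mlp_width (R : realType) m n (net : relu_mlp R m n) : nat :=
  match net with
  | MlpOutput _ _ _ _ => 0
  | MlpHidden _ k _ _ _ net' => maxn k (mlp_width net')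
  end.

Definition mx_nnz (R : realType) m n (A : 'M[R]_(m, n)) : nat :=
  #|[set ij : 'I_m * 'I_n | A ij.1 ij.2 != 0]|.

Fixpoint mlp_nnz (R : realType) m n (net : relu_mlp R m n) : nat :=
  match net with
  | MlpOutput _ _ W b => mx_nnz W + mx_nnz b
  | MlpHidden _ _ _ W b net' => mx_nnz W + mx_nnz b + mlp_nnz net'
  end%N.

Definition affine_on (R : realType) (I : interval R) (f : R -> R) : Prop :=
  exists a b : R, forall t : R, t \in I -> f t = a * t + b.

Definition constant_on (R : realType) (I : interval R) (f : R -> R) : Prop :=
  exists c : R, forall t : R, t \in I -> f t = c.

(* Main.v *)
(* Idea: let s = ceil (sqrt N).  Cut the sorted points into G <= s groups of s
   consecutive points; the first hidden layer has the 2G ramps relu (t - z) at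
   the two ends z of each group.  The interpolant is a constant plus a sum of
   kinks e_k relu (t - x_k).  For each position 1 <= i < s inside a group and
   each sign, a single second-layer neuron produces the kinks of that sign at
   that position in all groups at once: its pre-activation is affine on each
   group holding such a kink, with slope +-e_k and zero at x_k, the signs
   alternating from one such group to the next, so that there is no zero in
   between.  It only bends at the ends of these groups, which costs two weights
   per kink and hence at most 2 (N - G) weights overall, first points of groups
   being excluded.  What remains of the interpolant is a combination of the
   first-layer ramps, bounded below, hence given by one more neuron with 2G
   weights.  The total is at most 2N + 4G + 4s - 1. *)

Require Import Defs.
From HB Require Import structures.
From mathcomp Require Import all_boot all_order all_algebra.
From mathcomp Require Import reals.
From mathcomp Require Import ring lra zify.

Set Implicit Arguments.
Unset Strict Implicit.
Unset Printing Implicit Defensive.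

Import Order.TTheory GRing.Theory Num.Theory.

Local Open Scope ring_scope.

(** * Linear combinations of ramps *)

Section Ramps.
Variable R : realType.
Implicit Types (z p c al ga : nat -> R) (t A : R).

Lemma relu_ge0E t : 0 <= t -> relu t = t.
Proof. by move=> t0; rewrite /relu max_r. Qed.

Lemma relu_le0E t : t <= 0 -> relu t = 0.
Proof. by move=> t0; rewrite /relu max_l. Qed.

Lemma relu_ge0 t : 0 <= relu t.
Proof. by rewrite /relu le_max lexx. Qed.

Lemma relu_subN t : relu t - relu (- t) = t.
Proof.
case: (leP 0 t) => t0; last by rewrite relu_le0E ?ltW // relu_ge0E; lra.
by rewrite relu_ge0E // relu_le0E; lra.
Qed.

Definition ramps n z c t : R := \sum_(k < n) c k * relu (t - z k).

Lemma rampsS n z c t :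
  ramps n.+1 z c t = ramps n z c t + c n * relu (t - z n).
Proof. by rewrite /ramps big_ord_recr. Qed.

Lemma eq_ramps n z c1 c2 t :
  (forall k, (k < n)%N -> c1 k = c2 k) -> ramps n z c1 t = ramps n z c2 t.
Proof. by move=> h; apply: eq_bigr => k _; rewrite h. Qed.

Lemma ramps_affine n z c A t :
    (forall k, (k < n)%N -> z k <= A) -> A <= t ->
  ramps n z c t = ramps n z c A + (\sum_(k < n) c k) * (t - A).
Proof.
move=> zA At; rewrite /ramps mulr_suml -big_split /=; apply: eq_bigr => k _.
have zk := zA k (ltn_ord k).
by rewrite !relu_ge0E ?subr_ge0 ?(le_trans zk) //; ring.
Qed.

Lemma ramps_left n z c t :
  (forall k, (k < n)%N -> t <= z k) -> ramps n z c t = 0.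
Proof.
move=> h; rewrite /ramps big1 // => k _.
by rewrite relu_le0E ?mulr0 // subr_le0 h.
Qed.

(** For [t <= A] each ramp lies between 0 and its value at [A]. The bound later lets a shifted
    remainder pass through [relu] unchanged. *)
Lemma ramps_bounded n z c A :
  exists C, forall t, t <= A -> - C <= ramps n z c t.
Proof.
exists (\sum_(k < n) `|c k| * relu (A - z k)) => t tA.
rewrite -sumrN; apply: ler_sum => k _.
have h : relu (t - z k) <= relu (A - z k).
  by rewrite /relu le_max2 // lerB.
have h0 := relu_ge0 (t - z k).
have h1 := ler_norm (- c k); rewrite normrN in h1; have h2 := normr_ge0 (c k).
nra.
Qed.

(** * A single neuron producing kinks of one sign *)

Definition snoc2 n (f : nat -> R) (u w : R) (k : nat) : R :=
  if k == n then u else if k == n.+1 then w else f k.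

Lemma snoc2E n f u w :
  [/\ forall k, (k < n)%N -> snoc2 n f u w k = f k,
      snoc2 n f u w n = u & snoc2 n f u w n.+1 = w].
Proof.
rewrite /snoc2 eqxx eqn_leq ltnn /= eqxx; split=> // k kn.
by rewrite !ltn_eqF // ltnW.
Qed.

Lemma ramps_snoc2 n z f u w t :
  ramps n.+2 z (snoc2 n f u w) t =
  ramps n z f t + u * relu (t - z n) + w * relu (t - z n.+1).
Proof.
have [h1 h2 h3] := snoc2E n f u w.
by rewrite !rampsS h2 h3; congr (_ + _ + _); apply: eq_ramps.
Qed.

Lemma sum_snoc2 n f u w :
  \sum_(k < n.+2) snoc2 n f u w k = \sum_(k < n) f k + u + w.
Proof.
have [h1 h2 h3] := snoc2E n f u w.
rewrite !big_ord_recr /= h2 h3; congr (_ + _ + _).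
by apply: eq_bigr => k _; exact: h1.
Qed.

(* [eps] tells the sign of the pre-activation to the left of [A]; the crossing
   at [p n] uses up the bends at [A] and [B], and the slope [kappa] after [B]
   remains free.  [D] bounds the range on which the sign after [B] persists. *)
Lemma neuron_step n z p c v al d ga (eps : bool) kappa (D : R -> Prop) :
  let A := z n.*2 in let B := z n.*2.+1 in let sg : R := (-1) ^+ eps in
  let W := - sg * c n * (B - p n) in
    (forall k, (k < n.*2)%N -> z k <= A) -> (forall j, (j < n)%N -> p j <= A) ->
    A <= p n -> p n <= B -> 0 <= c n ->
    v + ramps n.*2 z al A = sg * c n * (p n - A) ->
    (forall t, t <= A -> relu (v + ramps n.*2 z al t) =
                         d + ramps n.*2 z ga t + ramps n p c t) ->
    (forall t, D t -> B <= t -> 0 <= - sg * (W + kappa * (t - B))) ->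
  exists al' ga',
    [/\ forall k, (k < n.*2)%N -> al' k = al k,
        \sum_(k < n.+1.*2) al' k = kappa,
        forall t, B <= t -> v + ramps n.+1.*2 z al' t = W + kappa * (t - B) &
        forall t, D t -> relu (v + ramps n.+1.*2 z al' t) =
                         d + ramps n.+1.*2 z ga' t + ramps n.+1 p c t].
Proof.
move=> A B sg W zA pA Ap pB c0 hA hid hD.
set S := \sum_(k < n.*2) al k.
set T := \sum_(k < n.*2) ga k + \sum_(k < n) c k.
(* The weight at [A] turns the accumulated slope [S] into [- sg * c n]; the weight at [B] turns that
   into [kappa]. *)
pose al' := snoc2 n.*2 al (- sg * c n - S) (kappa + sg * c n).
(* From [A] on, within [D], the output for [eps] true is 0 until [p n], then has slope [c n] until
   [B] and [kappa] after; for [eps] false it has slope [- c n] until [p n] and is 0 after. The bend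
   at [p n] is the new kink, so [ga'] supplies only those at [A] and [B]. *)
pose ga' := if eps then snoc2 n.*2 ga (- T) (kappa - c n)
            else snoc2 n.*2 ga (- c n - T) 0.
have [al1 _ _] := snoc2E n.*2 al (- sg * c n - S) (kappa + sg * c n).
have AB : A <= B by apply: le_trans pB.
have hL t : t <= A -> v + ramps n.+1.*2 z al' t = v + ramps n.*2 z al t.
  move=> tA; rewrite doubleS ramps_snoc2 -/A -/B !relu_le0E; [ring|lra|lra].
have hM t : A <= t -> t <= B ->
    v + ramps n.+1.*2 z al' t = - sg * c n * (t - p n).
  move=> tA tB; rewrite doubleS ramps_snoc2 (ramps_affine _ zA tA) -/A -/B -/S.
  rewrite (@relu_ge0E (t - A)) ?(@relu_le0E (t - B)); [|lra|lra].
  transitivity (v + ramps n.*2 z al A - sg * c n * (t - A)); first ring.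
  by rewrite hA; ring.
have hR t : B <= t -> v + ramps n.+1.*2 z al' t = W + kappa * (t - B).
  move=> tB; have tA := le_trans AB tB.
  rewrite doubleS ramps_snoc2 (ramps_affine _ zA tA) -/A -/B -/S.
  rewrite (@relu_ge0E (t - A)) ?(@relu_ge0E (t - B)); [|lra|lra].
  transitivity (v + ramps n.*2 z al A - sg * c n * (t - A)
                + (kappa + sg * c n) * (t - B)); first ring.
  by rewrite hA /W; ring.
exists al', ga'; split => //.
  by rewrite doubleS sum_snoc2 -/S; ring.
move=> t Dt; case: (leP t A) => tA.
  rewrite hL // hid // rampsS (@relu_le0E (t - p n)); last lra.
  suff -> : ramps n.+1.*2 z ga' t = ramps n.*2 z ga t by ring.
  rewrite doubleS /ga'; case: (eps);
    by rewrite ramps_snoc2 -/A -/B !relu_le0E; lra.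
have {}tA := ltW tA.
have hEA := hid A (lexx _); rewrite hA in hEA.
have -> : d + ramps n.+1.*2 z ga' t + ramps n.+1 p c t =
   relu (sg * c n * (p n - A)) + T * (t - A) + c n * relu (t - p n) +
   (if eps then (- T) * (t - A) + (kappa - c n) * relu (t - B)
    else (- c n - T) * (t - A)).
  rewrite hEA rampsS (ramps_affine _ pA tA) /ga' /T doubleS.
  case: (eps); rewrite ramps_snoc2 (ramps_affine _ zA tA) -/A -/B.
    by rewrite (@relu_ge0E (t - A)); [ring|lra].
  by rewrite (@relu_ge0E (t - A)); [ring|lra].
have hx u : 0 <= u -> 0 <= c n * u by move=> u0; apply: mulr_ge0.
have hDt := hD t Dt.
move: hM hR hDt; rewrite /W /sg; case: (eps) => /= hM hR hDt.
- rewrite (@relu_le0E (_ * _ * (p n - A))); last first.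
    by have := hx (p n - A); rewrite expr1; lra.
  case: (leP t B) => tB.
    rewrite hM // (@relu_le0E (t - B)); last lra.
    case: (leP t (p n)) => tp.
      rewrite (@relu_le0E (t - p n)); last lra.
      rewrite relu_le0E; first ring.
      by have := hx (p n - t); rewrite expr1; lra.
    rewrite (@relu_ge0E (t - p n)); last lra.
    rewrite relu_ge0E; first by rewrite expr1; ring.
    by have := hx (t - p n); rewrite expr1; lra.
  rewrite hR; last lra.
  rewrite (@relu_ge0E (t - B)) ?(@relu_ge0E (t - p n)); [|lra|lra].
  rewrite relu_ge0E; first by rewrite expr1; ring.
  by have := hDt (ltW tB); rewrite expr1; lra.
- rewrite expr0 in hM hR hDt *.
  rewrite (@relu_ge0E (_ * _ * (p n - A))); last first.
    by have := hx (p n - A); lra.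
  case: (leP t B) => tB.
    rewrite hM //.
    case: (leP t (p n)) => tp.
      rewrite (@relu_le0E (t - p n)); last lra.
      rewrite relu_ge0E; first ring.
      by have := hx (p n - t); lra.
    rewrite (@relu_ge0E (t - p n)); last lra.
    rewrite relu_le0E; first ring.
    by have := hx (t - p n); lra.
  rewrite hR; last lra.
  rewrite (@relu_ge0E (t - p n)); [|lra].
  rewrite relu_le0E; first ring.
  by have := hDt (ltW tB); lra.
Qed.

Section Neuron.
Variables (z p c : nat -> R).
Hypothesis z_le : {homo z : i j / (i <= j)%N >-> i <= j}.
Hypothesis z_lt : forall n, z n.*2.+1 < z n.+1.*2.
Hypothesis p_ge : forall n, z n.*2 <= p n.
Hypothesis p_le : forall n, p n <= z n.*2.+1.
Hypothesis c_ge0 : forall n, 0 <= c n.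

Let z_ltA n k : (k < n.*2)%N -> z k < z n.*2.
Proof.
case: n => // n; rewrite doubleS ltnS => kn.
by apply: le_lt_trans (z_lt n); exact: z_le.
Qed.

Let p_leA n j : (j < n)%N -> p j <= z n.*2.
Proof.
by move=> jn; apply: le_trans (p_le j) _; apply: z_le; lia.
Qed.

(** The sign [eps] flips at each nonzero [c j] and is fixed before [A] and [V], so the next group
    can still demand its own starting value of that sign. *)
Lemma neuron_prefix n : exists eps : bool, forall A V,
    (forall k, (k < n.*2)%N -> z k < A) -> 0 <= (-1) ^+ eps * V ->
  exists v al d ga,
    [/\ forall k, (k < n.*2)%N -> c k./2 = 0 -> al k = 0,
        v + ramps n.*2 z al A = V &
        forall t, t <= A -> relu (v + ramps n.*2 z al t) =
                            d + ramps n.*2 z ga t + ramps n p c t].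
Proof.
elim: n => [|n [eps IH]].
  exists false => A V _ V0; exists V, (fun=> 0), (relu V), (fun=> 0).
  by split=> // [|t _]; rewrite /ramps !big_ord0 ?addr0.
have [c0|c_neq0] := eqVneq (c n) 0.
  exists eps => A V zA V0.
  have zA' k : (k < n.*2)%N -> z k < A by move=> kn; apply: zA; lia.
  have [v [al [d [ga [h1 h2 h3]]]]] := IH A V zA' V0.
  exists v, (snoc2 n.*2 al 0 0), d, (snoc2 n.*2 ga 0 0).
  split.
  - rewrite doubleS => k; rewrite ltnS => k_le ck; rewrite /snoc2.
    by case: eqP => // kn; case: eqP => // kn1; apply: h1 => //; lia.
  - by rewrite doubleS ramps_snoc2 !mul0r !addr0.
  - by move=> t tA; rewrite doubleS !ramps_snoc2 rampsS c0 !mul0r !addr0 h3.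
exists (~~ eps) => A V zA V0.
pose sg : R := (-1) ^+ eps.
have sg2 : sg * sg = 1 by rewrite /sg; case: (eps); ring.
have hN : (-1) ^+ (~~ eps) = - sg by rewrite /sg; case: (eps); ring.
rewrite hN in V0.
have [] := IH (z n.*2) (sg * c n * (p n - z n.*2)) (@z_ltA n).
  by rewrite -/sg !mulrA sg2 mul1r mulr_ge0 // subr_ge0.
move=> v [al [d [ga [h1 h2 h3]]]].
set B := z n.*2.+1.
have BA : B < A by apply: zA; lia.
pose W := - sg * c n * (B - p n).
have W0 : 0 <= - sg * W.
  rewrite /W !mulrA mulrNN sg2 mul1r mulr_ge0 // subr_ge0 //; exact: p_le.
(* Slope of the segment from [W] at [B] to [V] at [A]. *)
pose kappa := (V - W) / (A - B).
have hk : kappa * (A - B) = V - W by rewrite divfK // subr_eq0 gt_eqF.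
have [k kn||] := @neuron_step n z p c v al d ga eps kappa (fun t => t <= A) _
    (@p_leA n) (p_ge n) (p_le n) (c_ge0 n) h2 h3.
- exact/ltW/z_ltA.
- move=> t tA tB; rewrite -/sg -/B -/W.
  rewrite -(pmulr_lge0 _ (_ : 0 < A - B)) ?subr_gt0 //.
  (* Up to the factor [A - B], the affine piece combines [W] and [V], both of sign [- sg], with
     nonnegative weights. *)
  have -> : - sg * (W + kappa * (t - B)) * (A - B) =
     (- sg * W) * (A - B) + - sg * (kappa * (A - B)) * (t - B) by ring.
  rewrite hk.
  have -> : - sg * W * (A - B) + - sg * (V - W) * (t - B) =
    (- sg * W) * (A - t) + (- sg * V) * (t - B) by ring.
  by apply: addr_ge0; apply: mulr_ge0; rewrite ?subr_ge0.
move=> al' [ga' [e1 _ e3 e4]].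
exists v, al', d, ga'; split => //.
- move=> k kn ck; case: (ltnP k n.*2) => kn2; first by rewrite e1 // h1.
  by move: c_neq0; rewrite -ck (_ : k./2 = n) ?eqxx //; lia.
- by rewrite e3 ?ltW // -/sg -/B -/W hk; ring.
Qed.

(** Unlike a prefix, the whole neuron ends with slope zero, hence is constant beyond its last
    ramp. *)
Lemma neuron_exists n : exists v al d ga,
  [/\ forall k, (k < n.*2)%N -> c k./2 = 0 -> al k = 0,
      \sum_(k < n.*2) al k = 0 &
      forall t, relu (v + ramps n.*2 z al t) =
                d + ramps n.*2 z ga t + ramps n p c t].
Proof.
elim: n => [|n [v [al [d [ga [h1 h2 h3]]]]]].
  exists 0, (fun=> 0), 0, (fun=> 0).
  by split=> // [|t]; rewrite /ramps !big_ord0 ?addr0 // relu_ge0E.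
have [c0|c_neq0] := eqVneq (c n) 0.
  exists v, (snoc2 n.*2 al 0 0), d, (snoc2 n.*2 ga 0 0).
  split.
  - rewrite doubleS => k; rewrite ltnS => k_le ck; rewrite /snoc2.
    by case: eqP => // kn; case: eqP => // kn1; apply: h1 => //; lia.
  - by rewrite doubleS sum_snoc2 h2 !addr0.
  - by move=> t; rewrite doubleS !ramps_snoc2 rampsS c0 !mul0r !addr0 h3.
(* Group [n] holds the last kink: the prefix before it replaces the induction hypothesis, and slope
   0 after its end keeps the sign for ever. *)
move=> {v al d ga h1 h2 h3}.
have [eps IH] := neuron_prefix n.
pose sg : R := (-1) ^+ eps.
have sg2 : sg * sg = 1 by rewrite /sg; case: (eps); ring.
have [] := IH (z n.*2) (sg * c n * (p n - z n.*2)) (@z_ltA n).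
  by rewrite -/sg !mulrA sg2 mul1r mulr_ge0 // subr_ge0.
move=> v [al [d [ga [h1 h2 h3]]]].
have [k kn||] := @neuron_step n z p c v al d ga eps 0 (fun=> True) _
    (@p_leA n) (p_ge n) (p_le n) (c_ge0 n) h2 h3.
- exact/ltW/z_ltA.
- move=> t _ _; rewrite -/sg mul0r addr0 !mulrA mulrNN sg2 mul1r.
  by rewrite mulr_ge0 // subr_ge0.
move=> al' [ga' [e1 e2 e3 e4]].
exists v, al', d, ga'; split => //; last by move=> t; exact: e4.
move=> k kn ck; case: (ltnP k n.*2) => kn2; first by rewrite e1 // h1.
by move: c_neq0; rewrite -ck (_ : k./2 = n) ?eqxx //; lia.
Qed.

End Neuron.

(** * Algebra of ramp sums, networks with two hidden layers, parameter counts *)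

Lemma ramps_sub n z c1 c2 t :
  ramps n z (fun k => c1 k - c2 k) t = ramps n z c1 t - ramps n z c2 t.
Proof. by rewrite /ramps -sumrB; apply: eq_bigr => k _; ring. Qed.

Lemma ramps_lincomb m n z (a : 'I_m -> R) (C : 'I_m -> nat -> R) t :
  ramps n z (fun k => \sum_i a i * C i k) t = \sum_i a i * ramps n z (C i) t.
Proof.
rewrite /ramps; under eq_bigr do rewrite mulr_suml.
rewrite exchange_big /=; apply: eq_bigr => i _.
by rewrite mulr_sumr; apply: eq_bigr => k _; ring.
Qed.

(** Asking for vanishing terms covers both zero coefficients and ramps not yet active at [t]. *)
Lemma ramps_widen m n z c t :
    (m <= n)%N -> (forall k, (m <= k < n)%N -> c k * relu (t - z k) = 0) ->
  ramps n z c t = ramps m z c t.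
Proof.
move=> mn h.
rewrite /ramps -!(big_mkord xpredT (fun k => c k * relu (t - z k))).
rewrite (big_cat_nat (n := m)) //= [X in _ + X]big_nat_cond.
rewrite [X in _ + X]big1 ?addr0 //.
by move=> k /andP[kb _]; exact: h.
Qed.

Lemma mx_nnzE m n (A : 'M[R]_(m, n)) :
  mx_nnz A = (\sum_i \sum_j (A i j != 0%R))%N.
Proof.
rewrite /mx_nnz -sum1dep_card pair_big_dep /= big_mkcond /=.
by apply: eq_bigr => ij _; case: (A _ _ != 0).
Qed.

Lemma mx_nnz_le m n (A : 'M[R]_(m, n)) : (mx_nnz A <= m * n)%N.
Proof. by apply: leq_trans (max_card _) _; rewrite card_prod !card_ord. Qed.

Definition mlp2 P M z (w : 'I_M -> nat -> R) (u o : 'I_M -> R) (C : R) :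
    relu_mlp R 1 1 :=
  MlpHidden (const_mx 1 : 'M_(P, 1)) (\col_k - z k)
    (MlpHidden (\matrix_(i, k) w i k) (\col_i u i)
      (MlpOutput (\row_i o i) (const_mx C))).

Lemma mlp2E P M z (w : 'I_M -> nat -> R) (u o : 'I_M -> R) (C t : R) :
  mlp_fun (mlp2 P z w u o C) t =
  \sum_i o i * relu (u i + ramps P z (w i) t) + C.
Proof.
rewrite /mlp_fun /= !mxE; congr (_ + _); apply: eq_bigr => i _.
rewrite !mxE addrC; congr (_ * relu (_ + _)); apply: eq_bigr => k _.
by rewrite !mxE big_ord1 !mxE mul1r.
Qed.

(** Only the middle matrix will be sparse; every other block is bounded by its size. *)
Lemma mlp2_nnz P M z (w : 'I_M -> nat -> R) (u o : 'I_M -> R) (C : R) :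
  (mlp_nnz (mlp2 P z w u o C) <=
   2 * P + \sum_i \sum_(k < P) (w i k != 0%R) + 2 * M + 1)%N.
Proof.
rewrite /= (mx_nnzE (\matrix_(i, k) w i k)).
under eq_bigr do under eq_bigr do rewrite mxE.
have := mx_nnz_le (const_mx 1 : 'M[R]_(P, 1)).
have := mx_nnz_le (\col_(k < P) - z k).
have := mx_nnz_le (\col_i u i).
have := mx_nnz_le (\row_i o i).
have := mx_nnz_le (const_mx C : 'M[R]_(1, 1)).
move: (mx_nnz (const_mx C)) (mx_nnz (\row_i o i)) (mx_nnz (\col_i u i))
  (mx_nnz (\col_(k < P) - z k)) (mx_nnz (const_mx 1)) (\sum_i _)%N.
lia.
Qed.

Lemma big_ord_mul T idx (op : Monoid.law idx) m n (F : nat -> T) :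
  \big[op/idx]_(k < m * n) F k =
  \big[op/idx]_(j < m) \big[op/idx]_(r < n) F (j * n + r)%N.
Proof.
elim: m => [|m IH]; first by rewrite !big_ord0.
by rewrite mulSnr big_split_ord /= big_ord_recr /= IH.
Qed.

Lemma big_ord_double T idx (op : Monoid.law idx) n (F : nat -> T) :
  \big[op/idx]_(k < n.*2) F k =
  \big[op/idx]_(j < n) op (F j.*2) (F j.*2.+1).
Proof.
elim: n => [|n IH]; first by rewrite !big_ord0.
by rewrite doubleS !big_ord_recr /= IH Monoid.mulmA.
Qed.

Definition cons_ord T n (a : T) (b : 'I_n -> T) (i : 'I_n.+1) : T :=
  if unlift ord0 i is Some j then b j else a.

Lemma cons_ord0 T n (a : T) (b : 'I_n -> T) : cons_ord a b ord0 = a.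
Proof. by rewrite /cons_ord unlift_none. Qed.

Lemma cons_ord_lift T n (a : T) (b : 'I_n -> T) j :
  cons_ord a b (lift ord0 j) = b j.
Proof. by rewrite /cons_ord liftK. Qed.

Lemma strict_mono (X : nat -> R) :
  (forall k, X k < X k.+1) -> {mono X : i j / (i <= j)%N >-> i <= j}.
Proof. by move=> h; apply: le_mono; apply: homo_ltn h; exact: lt_trans. Qed.

(** * The network realizing a spline with given kinks *)

Section Spline.
Variables (X e : nat -> R) (y0 : R) (n s' : nat).
Local Notation s := s'.+1.
Hypothesis X_lt : forall k, X k < X k.+1.
Hypothesis e_out : forall k, (n < k)%N -> e k = 0.
Hypothesis e_sum : \sum_(k < n.+1) e k = 0.
Hypothesis n_lt : (n < s * s)%N.

Let G := (n %/ s).+1.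
(** The first and last abscissae of group [j] have indices [j.*2] and [j.*2.+1]; the last group may
    run past [n], where [e] vanishes. *)
Let z k := X (k./2 * s + odd k * s')%N.
(** Position 0 of a group is left out: its kink is already a ramp of the first layer, with
    coefficient in [start]. *)
Let q (i j : nat) := (j * s + i./2.+1)%N.
Let p i j := X (q i j).
Let sg (i : nat) : R := (-1) ^+ odd i.
Let c i j := relu (sg i * e (q i j)).
Let f t := y0 + ramps n.+1 X e t.
Let start k := if odd k then 0 else e (k./2 * s)%N.

Let Xle := strict_mono X_lt.

Let G_le : (G <= s)%N.
Proof. by rewrite /G ltn_divLR. Qed.

Let n_ltG : (n < G * s)%N.
Proof. by rewrite /G -ltn_divLR. Qed.

Let neurons : exists (v d : 'I_(s'.*2) -> R) (al ga : 'I_(s'.*2) -> nat -> R),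
  forall i : 'I_(s'.*2), [/\
      forall k, (k < G.*2)%N -> c i k./2 = 0 -> al i k = 0,
      \sum_(k < G.*2) al i k = 0 &
      forall t, relu (v i + ramps G.*2 z (al i) t) =
                d i + ramps G.*2 z (ga i) t + ramps G (p i) (c i) t].
Proof.
have /fin_all_exists[U hU] (i : 'I_(s'.*2)) :
  exists u : (R * R) * ((nat -> R) * (nat -> R)),
    [/\ forall k, (k < G.*2)%N -> c i k./2 = 0 -> u.2.1 k = 0,
      \sum_(k < G.*2) u.2.1 k = 0 &
      forall t, relu (u.1.1 + ramps G.*2 z u.2.1 t) =
                u.1.2 + ramps G.*2 z u.2.2 t + ramps G (p i) (c i) t].
  have := ltn_ord i; move: (nat_of_ord i) => {}i i_lt.
  have [|j|j|j|j|v [al [d [ga h]]]] := @neuron_exists z (p i) (c i) _ _ _ _ _ G.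
  - apply: homo_leq => // [x y w|k]; first exact: le_trans.
    by rewrite /z Xle /= uphalf_half; case: (odd k) => /=; lia.
  - rewrite /z ltNge Xle doubleS /= !uphalf_double !doubleK odd_double /=.
    lia.
  - by rewrite /z /p /q Xle odd_double doubleK /=; lia.
  - by rewrite /z /p /q Xle /= odd_double uphalf_double /=; lia.
  - exact: relu_ge0.
  - by exists ((v, d), (al, ga)).
exists (fun i => (U i).1.1), (fun i => (U i).1.2).
by exists (fun i => (U i).2.1), (fun i => (U i).2.2).
Qed.

Let spline_split t :
  ramps n.+1 X e t =
  ramps G.*2 z start t + \sum_(i < s'.*2) sg i * ramps G (p i) (c i) t.
Proof.
(* Completes the last group with zero coefficients. *)
rewrite -(@ramps_widen n.+1 (G * s)) //; last first.
  by move=> k /andP[nk _]; rewrite e_out ?mul0r.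
rewrite /ramps (big_ord_mul _ _ _ (fun k => e k * relu (t - X k))).
rewrite (big_ord_double _ _ (fun k => start k * relu (t - z k))).
rewrite (big_ord_double _ _
  (fun i => sg i * \sum_(j < G) c i j * relu (t - p i j))) /=.
under [X in _ = _ + X]eq_bigr do rewrite !mulr_sumr -big_split /=.
rewrite [X in _ = _ + X]exchange_big -big_split /=; apply: eq_bigr => j _.
rewrite big_ord_recl; congr (_ + _).
  by rewrite /start /z /= odd_double /= doubleK mul0r addr0 !addn0.
apply: eq_bigr => r _.
rewrite /c /sg /p /q /= odd_double /= doubleK uphalf_double expr0 expr1.
(* Each coefficient is its positive part minus its negative part, one for each neuron of a pair. *)
by rewrite -[in LHS](relu_subN (e _)) /bump add1n !mul1r !mulN1r mulrBl.
Qed.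

(** A kink has one sign, so it occurs in only one neuron of its pair and costs at most two weights
    there. Each of the [G] groups has a first point of index at most [n], which costs nothing
    here. *)
Let nnz_hidden (al : 'I_(s'.*2) -> nat -> R) :
  (forall (i : 'I_(s'.*2)) k, (k < G.*2)%N -> c i k./2 = 0 -> al i k = 0) ->
  (\sum_i \sum_(k < G.*2) (al i k != 0%R) + 2 * G <= 2 * n.+1)%N.
Proof.
move=> h.
have h1 : (\sum_i \sum_(k < G.*2) (al i k != 0%R) <=
           \sum_(i < s'.*2) \sum_(j < G) 2 * (c i j != 0%R))%N.
  apply: leq_sum => i _.
  rewrite (big_ord_double _ _ (fun k => (al i k != 0) : nat)).
  apply: leq_sum => j _.
  have hj := ltn_ord j.
  have := h i j.*2; have := h i j.*2.+1.
  rewrite /= uphalf_double doubleK.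
  case: (c i j =P 0) => cj h1 h2 /=; last by case: (_ != _); case: (_ != _).
  by rewrite h1 ?h2 ?eqxx //; lia.
have h2 : (\sum_(i < s'.*2) \sum_(j < G) 2 * (c i j != 0%R) <=
           2 * \sum_(j < G) \sum_(r < s') (j * s + r.+1 < n.+1))%N.
  rewrite (big_ord_double _ _ (fun i => \sum_(j < G) 2 * (c i j != 0%R))%N) /=.
  under eq_bigr do rewrite -big_split /=.
  rewrite exchange_big big_distrr /=; apply: leq_sum => j _.
  rewrite big_distrr /=; apply: leq_sum => r _.
  rewrite /c /sg /q /= odd_double doubleK uphalf_double.
  rewrite expr0 expr1 mul1r mulN1r.
  case: ltnP => hr; last by rewrite e_out // oppr0 relu_ge0E ?eqxx.
  case: (leP 0 (e (j * s + r.+1))) => he.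
    rewrite (@relu_le0E (- _)) ?oppr_le0 // eqxx.
    by case: (_ != _).
  rewrite (@relu_le0E (e _)) ?ltW // eqxx.
  by case: (_ != _).
have h3 : (\sum_(j < G) \sum_(r < s') (j * s + r.+1 < n.+1) + G <= n.+1)%N.
  (* Writing [n.+1] as a count over all [G * s] indices allows a comparison group by group. *)
  have {2}<- : (\sum_(k < G * s) (k < n.+1) = n.+1)%N.
    rewrite -(big_mkord xpredT (fun k => (k < n.+1) : nat)).
    rewrite (big_cat_nat (n := n.+1)) //=.
    rewrite [X in (_ + X)%N]big_nat_cond.
    rewrite [X in (_ + X)%N]big1 ?addn0; last first.
      by move=> k /andP[/andP[nk _] _]; rewrite ltnNge nk.
    rewrite big_nat_cond (eq_bigr (fun=> 1%N)); last first.
      by move=> k /andP[/andP[_ ->]].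
    by rewrite -big_nat_cond sum_nat_const_nat subn0 muln1.
  rewrite (big_ord_mul _ _ _ (fun k => (k < n.+1) : nat)).
  rewrite -[X in (_ + X <= _)%N]card_ord -sum1_card -big_split /=.
  apply: leq_sum => j _; rewrite big_ord_recl /= addn0 addnC.
  apply: leq_add; last by apply: eq_leq; apply: eq_bigr.
  have : (j * s <= n)%N by rewrite -leq_divRL //; exact: ltn_ord j.
  by rewrite ltnS => ->.
lia.
Qed.

(* The kinks at position [r.+1] of the groups with positive (resp. negative)
   coefficient are produced by neuron [r.*2] (resp. [r.*2.+1]). *)
Lemma spline_mlp : exists Phi : relu_mlp R 1 1,
  [/\ (mlp_width Phi <= 2 * s)%N, mlp_depth Phi = 2%N,
      (mlp_nnz Phi <= 2 * n.+1 + 8 * s)%N &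
      forall t, mlp_fun Phi t = f t].
Proof.
have [v [d [al [ga hN]]]] := neurons.
pose h (i : 'I_(s'.*2)) t := v i + ramps G.*2 z (al i) t.
(* The remainder [g] is [f] minus the signed outputs of the kink neurons, written as a bias plus
   first-layer ramps. *)
pose D := y0 - \sum_(i < s'.*2) sg i * d i.
pose Ga k := start k - \sum_(i < s'.*2) sg i * ga i k.
pose g t := D + ramps G.*2 z Ga t.
have gE t : g t = f t - \sum_(i < s'.*2) sg i * relu (h i t).
  have -> : \sum_(i < s'.*2) sg i * relu (h i t) =
      \sum_(i < s'.*2) sg i * d i +
      \sum_(i < s'.*2) sg i * ramps G.*2 z (ga i) t
      + \sum_(i < s'.*2) sg i * ramps G (p i) (c i) t.
    rewrite -!big_split /=; apply: eq_bigr => i _; have [_ _ hi] := hN i.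
    by rewrite /h hi !mulrDr.
  by rewrite /g /Ga ramps_sub ramps_lincomb /f spline_split /D; ring.
(* Past [T], beyond all ramps, [f] is constant because the kinks sum to 0, and the kink neurons
   because their total slopes vanish; a bound for [t <= T] thus suffices. *)
have [C hC] : exists C, forall t, 0 <= g t + C.
  pose T := X (G * s)%N.
  have zT k : (k < G.*2)%N -> z k <= T.
    by rewrite /z Xle; case: (odd k) (odd_double_half k); nia.
  have [C0 hC0] := ramps_bounded G.*2 z Ga T.
  exists (C0 - D) => t; wlog tT : t / t <= T => [hw|].
    case: (leP t T) => tT; first exact: hw.
    have -> : g t = g T; last exact: hw.
    rewrite !gE; congr (_ - _).
      rewrite /f (@ramps_affine _ _ _ T) ?e_sum ?mul0r ?addr0 ?ltW //.
      by move=> k kn; rewrite Xle; lia.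
    apply: eq_bigr => i _; congr (_ * relu _); rewrite /h.
    have [_ a0 _] := hN i.
    by rewrite (@ramps_affine _ _ _ T) ?a0 ?mul0r ?addr0 ?ltW.
  by have := hC0 t tT; rewrite /g; lra.
(* Neuron 0 carries [g + C], where [relu] is the identity; the output bias [- C] undoes the
   shift. *)
exists (mlp2 G.*2 z (cons_ord Ga al) (cons_ord (D + C) v)
             (cons_ord 1 (fun i : 'I_(s'.*2) => sg i)) (- C)).
split => //.
- by rewrite /=; lia.
(* The first layer costs [4 * G], the remaining biases and output weights [4 * s' + 3]; the [2 * G]
   weights of neuron 0 are absorbed by [nnz_hidden]. *)
- apply: leq_trans (mlp2_nnz _ _ _ _ _ _) _.
  rewrite big_ord_recl cons_ord0.
  under [X in (_ + (_ + X) + _ + _)%N]eq_bigr do rewrite cons_ord_lift.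
  have /nnz_hidden : forall (i : 'I_(s'.*2)) k,
      (k < G.*2)%N -> c i k./2 = 0 -> al i k = 0.
    by move=> i; have [] := hN i.
  have : (\sum_(k < G.*2) (Ga k != 0%R) <= G.*2)%N.
    rewrite -[X in (_ <= X)%N]card_ord -sum1_card; apply: leq_sum => k _.
    exact: leq_b1.
  move: (\sum_(k < G.*2) _)%N (\sum_i _)%N => a b.
  by move: G_le; move: (G) => g0; lia.
- move=> t; rewrite mlp2E big_ord_recl !cons_ord0.
  under eq_bigr do rewrite !cons_ord_lift -/(h _ _).
  have -> : D + C + ramps G.*2 z Ga t = g t + C by rewrite /g; ring.
  by rewrite relu_ge0E // gE; ring.
Qed.

End Spline.

(** * From interpolation data to kinks *)

(** Kinks are jumps of slope, so the slope past [X k] telescopes to [m k]; the default 0 makes the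
    interpolant constant before [X 0]. The sum stops at [k], hence no upper bound on [t]. *)
Lemma interp_segment (X Y : nat -> R) k t :
    let m i := (Y i.+1 - Y i) / (X i.+1 - X i) in
    let e i := m i - (if i is j.+1 then m j else 0) in
    (forall i, X i < X i.+1) -> X k <= t ->
  Y 0%N + ramps k.+1 X e t = Y k + m k * (t - X k).
Proof.
move=> m e X_lt; elim: k => [|k IH] kt.
  by rewrite rampsS /ramps big_ord0 add0r /e subr0 relu_ge0E ?subr_ge0.
rewrite rampsS addrA IH; last by apply: le_trans kt; exact/ltW.
rewrite relu_ge0E ?subr_ge0 // /e.
have : m k * (X k.+1 - X k) = Y k.+1 - Y k.
  by rewrite divfK // subr_eq0 gt_eqF.
by move=> h; rewrite mulrBl -[Y k.+1](subrK (Y k)) -h; ring.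
Qed.

End Ramps.

Theorem theorem1p3 (R : realType) (N : nat) (x y : nat -> R)
  (N_gt0 : (0 < N)%N)
  (x_incr : forall k : nat, (1 <= k < N)%N -> x k < x k.+1) :
  exists Phi : relu_mlp R 1 1,
    [/\ (mlp_width Phi)%:Z <= 2 * Num.ceil (Num.sqrt (N%:R : R)),
        mlp_depth Phi = 2%N &
        (mlp_nnz Phi)%:Z <= 2 * N%:Z + 8 * Num.ceil (Num.sqrt (N%:R : R))]
    /\ [/\ forall k : nat, (1 <= k <= N)%N -> mlp_fun Phi (x k) = y k,
        forall k : nat, (1 <= k < N)%N ->
          affine_on `[x k, x k.+1] (mlp_fun Phi),
        constant_on `]-oo, x 1%N] (mlp_fun Phi) &
        constant_on `[x N, +oo[ (mlp_fun Phi)].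
Proof.
case: N N_gt0 x_incr => // n _ x_incr.
have sqrt_gt0 : 0 < Num.sqrt (n.+1%:R : R) by rewrite sqrtr_gt0 ltr0n.
have ceil0 : 0 < Num.ceil (Num.sqrt (n.+1%:R : R)) by rewrite ceil_gt0.
have [s' sE] : exists s', Num.ceil (Num.sqrt (n.+1%:R : R)) = s'.+1%:Z.
  by case: (Num.ceil _) ceil0 => [[|s']|] // _; exists s'.
have n_lt : (n < s'.+1 * s'.+1)%N.
  have := ceil_ge (Num.sqrt (n.+1%:R : R)); rewrite sE => sqrt_le.
  rewrite -(ler_nat R) natrM -(@sqr_sqrtr R n.+1%:R) ?ler0n // expr2.
  by rewrite ler_pM // ltW.
(* The data are continued past [x N] by a constant on unit steps, so that the
   last group of points need not be treated separately. *)
pose X k := if (k <= n)%N then x k.+1 else x n.+1 + (k - n)%:R.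
pose Y k := if (k <= n)%N then y k.+1 else y n.+1.
pose m k := (Y k.+1 - Y k) / (X k.+1 - X k).
pose e k := m k - (if k is j.+1 then m j else 0).
have XE k : (k <= n)%N -> X k = x k.+1 by rewrite /X => ->.
have YE k : (k <= n)%N -> Y k = y k.+1 by rewrite /Y => ->.
have X_lt k : X k < X k.+1.
  rewrite /X; case: (ltngtP k n) => [kn|kn|->].
  - by apply: x_incr.
  - by rewrite ltrD2l ltr_nat; lia.
  - by rewrite subSnn ltrDl ltr01.
have Y_out k : (n <= k)%N -> Y k = y n.+1.
  rewrite /Y leq_eqVlt => /orP[/eqP<-|nk]; first by rewrite leqnn.
  by rewrite leqNgt nk.
have m_out k : (n <= k)%N -> m k = 0.
  by move=> nk; rewrite /m !Y_out ?subrr ?mul0r // (leq_trans nk).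
have e_out k : (n < k)%N -> e k = 0.
  by case: k => // k nk; rewrite /e !m_out ?subr0 //; lia.
(* Telescoping; at [n] the continued data give [m n = 0], the zero total required of the kinks. *)
have e_sum k : \sum_(i < k.+1) e i = m k.
  elim: k => [|k IH]; first by rewrite big_ord1 /e subr0.
  by rewrite big_ord_recr /= IH /e; ring.
have [|Phi [wd dp nz PhiE]] := spline_mlp (Y 0%N) X_lt e_out _ n_lt.
  by rewrite e_sum m_out.
have Xle := strict_mono X_lt.
(* For [k = n] no upper bound is imposed on [t], so the last half-line is covered too. *)
have segE k t : (k <= n)%N -> X k <= t -> ((k < n)%N -> t <= X k.+1) ->
    mlp_fun Phi t = Y k + m k * (t - X k).
  move=> kn kt tk; rewrite PhiE (ramps_widen (m := k.+1)) //.
    exact: interp_segment.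
  move=> i /andP[ki i_n]; rewrite relu_le0E ?mulr0 // subr_le0.
  by apply: le_trans (tk _) _; rewrite ?Xle //; lia.
exists Phi; split; split => //.
- by rewrite sE; lia.
- by rewrite sE; lia.
- move=> [|k] // /andP[_ kn]; rewrite -XE // (segE k) ?lexx //.
    by rewrite subrr mulr0 addr0 YE.
  by move=> _; rewrite ltW.
- move=> [|k] // /andP[_ kn]; exists (m k), (Y k - m k * X k) => t.
  rewrite in_itv /= => /andP[tl tr].
  have k_le : (k <= n)%N by exact: ltnW.
  by rewrite (segE k) ?XE // mulrBr addrCA.
- exists (Y 0%N) => t; rewrite in_itv /= => t1.
  rewrite PhiE ramps_left ?addr0 // => k _; apply: le_trans t1 _.
  by rewrite -(XE 0%N) // Xle.
- exists (Y n) => t; rewrite in_itv /= andbT => tn.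
  by rewrite (segE n) ?(XE n) ?m_out ?mul0r ?addr0 ?ltnn.
Qed.
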